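(* Let $p \ge 6$, $k \ge 1$ and $n \ge 36$ be integers. Consider the $(1,k)$-nacci Zeckendorf game (that is, $c = 1$) starting from $n$ copies of $S_1 = 1$, played by $p$ players divided into two teams, one with $p-2$ players and the other with two players. Then the larger team has a winning strategy.
   Context: For an integer $k \ge 1$, the $(1,k)$-nacci numbers are defined by $S_1 = 1$; $S_{i+1} = S_i + S_{i-1} + \cdots + S_1 + 1$ for $1 \le i \le k$; and $S_{i+1} = S_i + S_{i-1} + \cdots + S_{i-k}$ for $i \ge k+1$. The $(1,k)$-nacci Zeckendorf game with $p$ players on $n$: a position is a finite unordered list (multiset) of $(1,k)$-nacci numbers; the initial position consists of $n$ copies of $S_1$. Players $1, 2, \dots, p$ take turns in cyclic order, starting with Player $1$ (Player $1$ moves again after Player $p$). Here $2S_i$ denotes two copies of $S_i$. On each turn the player whose turn it is makes one of the following moves, provided the terms on the left are present in the list with at least the indicated multiplicities; they are removed and replaced by the terms on the right: 1. $S_{i-k} \wedge S_{i-k+1} \wedge \cdots \wedge S_i \to S_{i+1}$, for $i \ge k+1$; 2. $2S_1 \wedge S_2 \wedge \cdots \wedge S_i \to S_{i+1}$, for $1 \le i \le k$; 3. (a) $2S_1 \to S_2$; (b) $2S_i \to S_{i+1}$ for $1 < i < k+1$; (c) $2S_{k+1} \to S_{k+2} \wedge S_1$; (d) $2S_i \to S_{i+1} \wedge S_{i-k-1}$ for $i > k+1$. The game ends when no move is available. In the team version (Team Generalized Zeckendorf Game) the players are partitioned into teams (in any arrangement; members of a team need not be consecutive in the turn order), and the team containing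 the player who made the final move wins. A team has a winning strategy if its members, acting jointly, can guarantee that one of them makes the final move no matter what moves the players outside the team make. *)

(* Defs.v *)
From mathcomp Require Import all_boot.
From mathcomp Require Import finmap multiset.

Set Implicit Arguments.
Unset Strict Implicit.
Unset Printing Implicit Defensive.

Local Open Scope nat_scope.
Local Open Scope mset_scope.

(* The list S_m, ..., S_1 of the first m (1,k)-nacci numbers, latest first. *)
Fixpoint nacci_seq (k m : nat) : seq nat :=
  if m is i.+1 then
    let s := nacci_seq k i in
    (if i <= k then sumn s + 1 else sumn (take k.+1 s)) :: s
  else [::].

(* S_i for i >= 1; index 0 is junk. *)
Definition nacci (k i : nat) : nat := head 0 (nacci_seq k i).

Lemma nacci_seqE k m : nacci_seq k m = [seq nacci k i | i <- rev (iota 1 m)].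
Proof.
elim: m => // m IHm.
by rewrite -addn1 iotaD rev_cat map_cat /= -IHm add1n addn1.
Qed.

Lemma nacci1 k : nacci k 1 = 1.
Proof. by []. Qed.

Lemma nacciS_small k i : 1 <= i <= k ->
  nacci k i.+1 = \sum_(1 <= j < i.+1) nacci k j + 1.
Proof.
case/andP=> _ le_ik; rewrite {1}/nacci /= le_ik nacci_seqE map_rev sumn_rev.
by rewrite sumnE big_map /index_iota subn1.
Qed.

Lemma nacciS_large k i : k + 1 <= i ->
  nacci k i.+1 = \sum_(i - k <= j < i.+1) nacci k j.
Proof.
rewrite addn1 => lt_ki; rewrite {1}/nacci /= leqNgt lt_ki /=.
rewrite nacci_seqE -map_take take_rev size_iota drop_iota map_rev sumn_rev.
rewrite sumnE big_map /index_iota.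
have -> : 1 + (i - k.+1) = i - k by rewrite add1n subnSK.
suff -> : i - (i - k.+1) = i.+1 - (i - k) by [].
by rewrite subKn // subSn ?leq_subr // subKn // ltnW.
Qed.

Definition position := {mset nat}.

Definition start (k n : nat) : position := msetn n (nacci k 1).

(* rule k l r : the terms listed in l may be replaced by those listed in r. *)
Inductive rule (k : nat) : seq nat -> seq nat -> Prop :=
| rule_combine i : k + 1 <= i ->
    rule k [seq nacci k j | j <- index_iota (i - k) i.+1] [:: nacci k (i + 1)]
| rule_combine_initial i : 1 <= i <= k ->
    rule k ([:: nacci k 1; nacci k 1]
              ++ [seq nacci k j | j <- index_iota 2 i.+1])
           [:: nacci k (i + 1)]
| rule_merge_ones :
    rule k [:: nacci k 1; nacci k 1] [:: nacci k 2]
| rule_merge i : 1 < i < k + 1 ->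
    rule k [:: nacci k i; nacci k i] [:: nacci k (i + 1)]
| rule_split_initial :
    rule k [:: nacci k (k + 1); nacci k (k + 1)]
           [:: nacci k (k + 2); nacci k 1]
| rule_split i : k + 1 < i ->
    rule k [:: nacci k i; nacci k i]
           [:: nacci k (i + 1); nacci k (i - k - 1)].

Definition move (k : nat) (x y : position) : Prop :=
  exists l r : seq nat,
    [/\ rule k l r, seq_mset l `<=` x & y = (x `\` seq_mset l) `+` seq_mset r].

Definition terminal (k : nat) (x : position) : Prop :=
  forall y : position, ~ move k x y.

(* Players and turns are numbered from 0, so that turn t belongs to player
   t mod p. *)
Definition on_turn (p : nat) (T : {set 'I_p}) (t : nat) : Prop :=
  exists2 i : 'I_p, i \in T & i = t %% p :> nat.

(* A play is the sequence of the positions reached after each successive move;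
   the starting position is not listed, so its size is the number of moves. *)
Fixpoint legal_play (k : nat) (x : position) (s : seq position) : Prop :=
  if s is y :: s' then move k x y /\ legal_play k y s' else True.

(* A joint strategy maps the play so far to the next position; it is consulted
   only when a member of the team is to move. *)
Definition strategy := seq position -> position.

Definition conforming_play (k n p : nat) (T : {set 'I_p}) (sigma : strategy)
    (s : seq position) : Prop :=
  legal_play k (start k n) s /\
  forall t, t < size s -> on_turn T t ->
    nth (start k n) s t = sigma (take t s).

(* The strategy always prescribes a legal move, every finished play that
   conforms to it has its final move made by the team, and no conforming play
   goes on forever. *)
Definition winning_strategy (k n p : nat) (T : {set 'I_p})
    (sigma : strategy) : Prop :=
  [/\ forall s, conforming_play k n T sigma s ->
        ~ terminal k (last (start k n) s) -> on_turn T (size s) ->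
        move k (last (start k n) s) (sigma s),
      forall s, conforming_play k n T sigma s ->
        terminal k (last (start k n) s) ->
        exists2 t, size s = t.+1 & on_turn T t
    & forall f : nat -> position,
        ~ (forall m, conforming_play k n T sigma (mkseq f m))].

Definition has_winning_strategy (k n p : nat) (T : {set 'I_p}) : Prop :=
  exists sigma : strategy, winning_strategy k n T sigma.

(* Main.v *)
Require Import Defs.
From mathcomp Require Import all_boot.
From mathcomp Require Import finmap multiset zify.
From Stdlib Require Import Classical ClassicalEpsilon Wf_nat.

Set Implicit Arguments.
Unset Strict Implicit.
Unset Printing Implicit Defensive.

(** Call A the team of p - 2 players and B the team of two.  The game stops
    because every move keeps the sum of the list and raises the sum of its
    squares ([move_wf]).

    The engine is a strategy-stealing argument ([stealing]).  Suppose that the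
    turns t and t + c never both belong to B.  Then A wins from any given
    position either when it is reached at one turn or when it is reached c
    turns later: if B won both ways, the two games could be played in parallel
    on the same list, each move being dictated by B's winning strategy in the
    game where B is to move (there is at most one), and in at least one of them
    A would make the final move.  Hence A wins as soon as it can, by its own
    choice, reach one position in two ways whose lengths differ by c.

    Such detours come from a single exchange, uniform in k: the terms 1, 1, 2
    can be replaced by [fusion k], the result of merging 2, 2, in one move, or
    in two by merging 1, 1 into 2 and then fusing 2, 2 ([reach_triple]).

    If the two B players are never consecutive, c = 1 works.  It is enough that
    A has two turns in a row while 1, 1, 2 are on the list; of three turns in a
    row, the first can make the 2.  In a turn pattern AABAA, A first makes two
    2s.  If the B player fuses them, the outcome is one that A could have
    produced alone a turn earlier; any other move leaves a 2 for the next pair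
    of turns ([wins_AA_AA]).

    If they are consecutive, c = 2 works because p > 3, and two exchanges within
    four A turns in a row are wanted, hence two 2s on the list.  Six A turns in
    a row allow for making these first.  With shorter blocks, A spends four
    turns making four 2s.  If both B players fuse, A could have produced the
    outcome alone two turns earlier; otherwise at least one 2 survives the
    round, and two of them survive the next round ([wins_round],
    [wins_three_blocks]).  For p = 6 this costs at most 26 ones, after a wait of
    at most five moves of two ones each, which accounts for the bound 36. *)

Local Open Scope nat_scope.
Local Open Scope mset_scope.

(** * Arithmetic of the nacci numbers *)

(* Otherwise unification unfolds the recursion on numeric indices. *)
#[local] Opaque nacci.

Lemma nacci_gt0 k i : 0 < i -> 0 < nacci k i.
Proof.
elim/ltn_ind: i => [] [//|[//|i]] IHi _.
have [le_ik|lt_ki] := leqP i.+1 k; first by rewrite nacciS_small // addn1.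
rewrite nacciS_large ?addn1 // big_nat_recr ?leq_subr //= ltn_addl //.
exact: IHi.
Qed.

Lemma nacci_ltS k i : 0 < k -> 0 < i -> nacci k i < nacci k i.+1.
Proof.
move=> k_gt0 i_gt0; have [le_ik|lt_ki] := leqP i k.
  by rewrite nacciS_small ?i_gt0 // addn1 ltnS big_nat_recr //= leq_addl.
rewrite nacciS_large ?addn1 // big_nat_recr ?leq_subr //=.
case: i => // i in i_gt0 lt_ki *.
rewrite big_nat_recr ?leq_subLR ?addnS /=; last by lia.
by rewrite -[X in X < _]add0n ltn_add2r ltn_addl // nacci_gt0 //; lia.
Qed.

Lemma nacci_ltn k i j : 0 < k -> 0 < i -> i < j -> nacci k i < nacci k j.
Proof.
move=> k_gt0 i_gt0; elim: j => // j IHj; rewrite ltnS leq_eqVlt => /predU1P[<-|lt_ij].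
  exact: nacci_ltS.
by apply: ltn_trans (IHj lt_ij) (nacci_ltS _ _) => //; lia.
Qed.

Lemma nacci_inj k : 0 < k -> {in [pred i | 0 < i] &, injective (nacci k)}.
Proof.
move=> k_gt0 i j; rewrite !inE => i_gt0 j_gt0 eq_ij.
case: (ltngtP i j) => // [lt_ij|lt_ji].
  by have := nacci_ltn k_gt0 i_gt0 lt_ij; rewrite eq_ij ltnn.
by have := nacci_ltn k_gt0 j_gt0 lt_ji; rewrite eq_ij ltnn.
Qed.

Lemma nacci2 k : 0 < k -> nacci k 2 = 2.
Proof. by move=> k_gt0; rewrite nacciS_small ?k_gt0 // big_nat1. Qed.

Lemma nacci_double_small k i : 0 < i <= k -> (nacci k i).*2 = nacci k i.+1.
Proof.
case/andP=> i_gt0 le_ik; rewrite [RHS]nacciS_small ?i_gt0 // big_nat_recr //= -addnn.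
case: i => [|[|i]] // in i_gt0 le_ik *; first by rewrite big_geq.
have lt_ik : 0 < i.+1 <= k by apply: ltnW.
by rewrite {1}(nacciS_small lt_ik) addnAC.
Qed.

Lemma nacci_double_initial k :
  0 < k -> (nacci k (k + 1)).*2 = nacci k (k + 2) + nacci k 1.
Proof.
move=> k_gt0; rewrite addn2 nacciS_large ?addn1 // subSnn big_nat_recr //=.
have le_kk : 0 < k <= k by rewrite k_gt0 leqnn.
by rewrite -addnn {1}(nacciS_small le_kk) addnAC !addn1.
Qed.

Lemma nacci_double k i :
  k + 1 < i -> (nacci k i).*2 = nacci k (i + 1) + nacci k (i - k - 1).
Proof.
move=> lt_ki; rewrite addn1 nacciS_large ?(ltnW lt_ki) // big_nat_recr ?leq_subr //=.
rewrite -addnn addnAC; congr (_ + _).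
case: i lt_ki => // i lt_ki; rewrite {1}nacciS_large; last by lia.
rewrite big_ltn; last by lia.
have -> : i.+1 - k - 1 = i - k by lia.
by have -> : i.+1 - k = (i - k).+1; [lia | rewrite addnC].
Qed.

(** * Termination *)

Lemma sum_sqr_le s : \sum_(v <- s) v ^ 2 <= (\sum_(v <- s) v) ^ 2.
Proof.
elim: s => [|v s IHs]; first by rewrite !big_nil.
by rewrite !big_cons sqrnD; lia.
Qed.

Lemma sum_sqr_lt s : all (ltn 0) s -> 1 < size s ->
  \sum_(v <- s) v ^ 2 < (\sum_(v <- s) v) ^ 2.
Proof.
case: s => [|a [|b s]] //= /and3P[a_gt0 b_gt0 _] _; rewrite big_cons [X in _ < X ^ _]big_cons.
rewrite sqrnD; have : 0 < \sum_(v <- b :: s) v by rewrite big_cons ltn_addr.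
by have := sum_sqr_le (b :: s); nia.
Qed.

Lemma sqr_spread a b c : c.*2 = a + b -> c < a -> c ^ 2 + c ^ 2 < a ^ 2 + b ^ 2.
Proof.
move=> eq_c lt_ca; have [d [d_gt0 -> Ec]] : exists d, [/\ 0 < d, a = c + d & c = b + d].
  by exists (a - c); split; lia.
by rewrite sqrnD {1 2 3 4}Ec !sqrnD; nia.
Qed.

(** Combining positive terms increases the sum of squares because the cross
    terms appear; a split replaces c, c by two distinct numbers of the same sum,
    and so increases it by convexity. *)
Lemma rule_spreads k l r : 0 < k -> rule k l r ->
  \sum_(v <- l) v = \sum_(v <- r) v /\ \sum_(v <- l) v ^ 2 < \sum_(v <- r) v ^ 2.
Proof.
move=> k_gt0; have combine s v : all (ltn 0) s -> 1 < size s -> \sum_(u <- s) u = v ->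
    \sum_(u <- s) u = \sum_(u <- [:: v]) u /\
    \sum_(u <- s) u ^ 2 < \sum_(u <- [:: v]) u ^ 2.
  by move=> s_gt0 s_gt1 <-; rewrite !big_seq1; split=> //; apply: sum_sqr_lt.
have split c a b : c.*2 = a + b -> c < a ->
    \sum_(u <- [:: c; c]) u = \sum_(u <- [:: a; b]) u /\
    \sum_(u <- [:: c; c]) u ^ 2 < \sum_(u <- [:: a; b]) u ^ 2.
  by move=> eq_c lt_ca; rewrite !big_cons !big_nil !addn0 addnn; split=> //; apply: sqr_spread.
have lt_nacci i j : 0 < i -> i < j -> nacci k i < nacci k j by apply: nacci_ltn.
case=> [i lt_ki|i /andP[i_gt0 le_ik]||i /andP[i_gt1 le_ik]||i lt_ki].
- apply: combine.
  + apply/allP=> _ /mapP[j + ->]; rewrite mem_index_iota => /andP[le_j _].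
    by apply: nacci_gt0; lia.
  + by rewrite size_map size_iota; lia.
  + by rewrite big_map addn1 nacciS_large.
- apply: combine.
  + rewrite /= !nacci_gt0 //; apply/allP=> _ /mapP[j + ->].
    by rewrite mem_index_iota => /andP[le_j _]; apply: nacci_gt0; lia.
  + by [].
  + have le_ik' : 0 < i <= k by rewrite i_gt0.
    rewrite !big_cons big_map addn1 (nacciS_small le_ik') [in RHS]big_ltn //.
    by rewrite nacci1 addnC.
- by apply: combine; rewrite //= !big_cons big_nil nacci2.
- apply: combine; rewrite /= ?nacci_gt0 //; try lia.
  by rewrite !big_cons big_nil addn0 addnn addn1 nacci_double_small //; lia.
- by apply: split; [apply: nacci_double_initial | apply: lt_nacci; lia].
- by apply: split; [apply: nacci_double | apply: lt_nacci; lia].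
Qed.

Lemma sum_msetD (f : nat -> nat) (x y : {mset nat}) :
  \sum_(v <- x `+` y) f v = \sum_(v <- x) f v + \sum_(v <- y) f v.
Proof.
rewrite -big_cat; apply: perm_big; apply/allP=> v _ /=.
by rewrite count_cat !count_mem_mset msetE2.
Qed.

Lemma sum_seq_mset (f : nat -> nat) (s : seq nat) :
  \sum_(v <- seq_mset s) f v = \sum_(v <- s) f v.
Proof. exact/perm_big/perm_eq_seq_mset. Qed.

(** Moves are composed and compared in this form, since differences of
    multisets are truncated. *)
Lemma moveE k x y : move k x y <->
  exists l r z, [/\ rule k l r, x = seq_mset l `+` z & y = seq_mset r `+` z].
Proof.
split=> [[l [r [lr le_lx ->]]]|[l [r [z [lr -> ->]]]]].
  by exists l, r, (x `\` seq_mset l); rewrite msetBDKC // msetDC.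
exists l, r; split; [by [] | | by rewrite msetDKB msetDC].
by rewrite -[X in X `<=` _]msetD0 msetDS // msub0set.
Qed.

(** The sum of squares grows with each move, but stays below the square of the
    sum, which is constant. *)
Lemma move_wf k : 0 < k -> well_founded (fun y x => move k x y).
Proof.
move=> k_gt0.
pose q (x : {mset nat}) := (\sum_(v <- x) v) ^ 2 - \sum_(v <- x) v ^ 2.
apply: (well_founded_lt_compat position q) => y x /moveE[l [r [z [lr -> ->]]]].
have [eq_lr lt_lr] := rule_spreads k_gt0 lr.
have := sum_sqr_le (seq_mset r `+` z).
by rewrite /q !sum_msetD !sum_seq_mset eq_lr; lia.
Qed.

(** * What moves do to the ones and the twos *)

Ltac mset_lia := apply/msetP=> v; rewrite !(msetE2, mset_seqE) /=; lia.

(** The result of merging two copies of 2.  The case k = 1 is singular because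
    2 is then S_{k+1}, and its double is a split. *)
Definition fusion k := if k == 1 then [:: nacci k 3; 1] else [:: nacci k 3].

Lemma rule_pair k : 0 < k -> rule k [:: 2; 2] (fusion k).
Proof.
rewrite /fusion => k_gt0; case: eqP => [->|neq_k1].
  by have := rule_split_initial 1; rewrite nacci2.
by have := @rule_merge k 2; rewrite nacci2 //; apply; lia.
Qed.

Lemma move_ones k z :
  0 < k -> move k (seq_mset [:: 1; 1] `+` z) (seq_mset [:: 2] `+` z).
Proof.
move=> k_gt0; apply/moveE; exists [:: 1; 1], [:: 2], z; split=> //.
by have := rule_merge_ones k; rewrite nacci2.
Qed.

Lemma move_pair k z :
  0 < k -> move k (seq_mset [:: 2; 2] `+` z) (seq_mset (fusion k) `+` z).
Proof.
by move=> k_gt0; apply/moveE; exists [:: 2; 2], (fusion k), z; split=> //; apply: rule_pair.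
Qed.

(** For k >= 2 this is an initial combination.  For k = 1 only 1 and 2 are
    combined, and the spare 1 is the one that a split of 2, 2 would return. *)
Lemma move_triple k z :
  0 < k -> move k (seq_mset [:: 1; 1; 2] `+` z) (seq_mset (fusion k) `+` z).
Proof.
rewrite /fusion => k_gt0; apply/moveE; case: eqP => [->|neq_k1].
  exists [:: 1; 2], [:: nacci 1 3], (seq_mset [:: 1] `+` z); split; try mset_lia.
  by have := @rule_combine 1 2 isT; rewrite /= nacci2.
exists [:: 1; 1; 2], [:: nacci k 3], z; split=> //.
by have := @rule_combine_initial k 2; rewrite /= nacci2 //; apply; lia.
Qed.

(** The left side of a rule has pairwise distinct terms, except for a doubled 1
    or for a pair c, c; in the latter case c = 2 forces the fusion. *)
Lemma rule_takes k l r : 0 < k -> rule k l r ->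
  (l = [:: 2; 2] /\ r = fusion k) \/ (count_mem 1 l <= 2 /\ count_mem 2 l <= 1).
Proof.
move=> k_gt0.
have uniq_nacci m n : 0 < m -> uniq [seq nacci k j | j <- index_iota m n].
  move=> m_gt0; rewrite map_inj_in_uniq ?iota_uniq // => i j.
  rewrite !mem_index_iota => /andP[le_mi _] /andP[le_mj _].
  by apply: nacci_inj => //; rewrite inE; lia.
have twin i : 1 < i -> i != 2 -> count_mem 1 [:: nacci k i; nacci k i] <= 2 /\
    count_mem 2 [:: nacci k i; nacci k i] <= 1.
  move=> i_gt1 neq_i2; have : nacci k 2 < nacci k i by apply: nacci_ltn => //; lia.
  by rewrite nacci2 //=; lia.
case=> [i lt_ki|i /andP[i_gt0 le_ik]||i /andP[i_gt1 le_ik]||i lt_ki].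
- by right; rewrite !count_uniq_mem ?uniq_nacci; lia.
- right; rewrite !count_cat /= nacci1 !count_uniq_mem ?uniq_nacci //.
  suff /negbTE-> : 1 \notin [seq nacci k j | j <- index_iota 2 i.+1] by case: (_ \in _).
  apply/mapP=> -[j]; rewrite mem_index_iota => /andP[j_gt1 _].
  by have := nacci_ltn k_gt0 (ltn0Sn 0) j_gt1; rewrite nacci1; lia.
- by right; rewrite /= nacci1.
- have [->|neq_i2] := eqVneq i 2; last by right; apply: twin.
  by left; rewrite nacci2 // /fusion; case: eqP => //; lia.
- have [->|neq_k1] := eqVneq k 1; last by right; apply: twin; lia.
  by left; rewrite nacci2.
- by right; apply: twin; lia.
Qed.

Lemma move_effect k x y : 0 < k -> move k x y ->
  (exists z, x = seq_mset [:: 2; 2] `+` z /\ y = seq_mset (fusion k) `+` z)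
  \/ (x 1 <= y 1 + 2 /\ x 2 <= y 2 + 1).
Proof.
move=> k_gt0 /moveE[l [r [z [/(rule_takes k_gt0)[[-> ->]|[l1 l2]] -> ->]]]].
  by left; exists z.
right; rewrite !msetE2 -!mset_seqE in l1 l2 *.
by split; lia.
Qed.

Lemma split_position (s : seq nat) (x : position) :
  (forall v, count_mem v s <= x v) -> exists z, x = seq_mset s `+` z.
Proof.
move=> le_sx; exists (x `\` seq_mset s); rewrite msetBDKC //.
by apply/msubsetP=> v; rewrite mset_seqE.
Qed.

(** * Winning positions and strategy stealing *)

Section Winning.
Variables (k : nat) (A : nat -> Prop).
Hypothesis k_gt0 : 0 < k.

(** Here t is the number of moves already made and A the set of turns of the
    team.  The second constructor also allows the team to leave the choice of
    its own move open, so that the result does not depend on who is to move.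
    In the third, the final move was made at turn t; this is why times after at
    least one move are successors, as in [stealing]. *)
Inductive wins : nat -> position -> Prop :=
| wins_choose t x y : A t -> move k x y -> wins t.+1 y -> wins t x
| wins_reply t x : ~ terminal k x -> (forall y, move k x y -> wins t.+1 y) -> wins t x
| wins_last t x : A t -> terminal k x -> wins t.+1 x.

Lemma loses_choose t x y : A t -> move k x y -> ~ wins t x -> ~ wins t.+1 y.
Proof. by move=> At xy Nx Wy; apply: Nx; apply: wins_choose At xy Wy. Qed.

Lemma loses_reply t x :
  ~ terminal k x -> ~ wins t x -> exists2 y, move k x y & ~ wins t.+1 y.
Proof.
move=> open_x Nx; apply: NNPP => noy; apply: Nx; apply: wins_reply => // y xy.
by apply: NNPP => Ny; apply: noy; exists y.
Qed.

(** Suppose that the team wins at neither time.  At each step at least one of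
    the two games is at a turn of the team, where every move keeps it lost;
    so some move keeps both lost.  Since moves come to an end, both would end
    with a final move of the opponents, at turns c apart. *)
Lemma stealing c : (forall t, A t \/ A (t + c)) ->
  forall x t, wins t.+1 x \/ wins (t + c).+1 x.
Proof.
move=> shift; elim/(well_founded_ind (move_wf k_gt0)) => x IHx t.
apply: NNPP => /not_or_and[Nt Ntc].
have [term_x|open_x] := classic (terminal k x).
  by case: (shift t) => /wins_last/(_ term_x).
case: (shift t.+1) => At.
  have [y xy Ny] := loses_reply open_x Ntc.
  case: (IHx _ xy t.+1) => [Wy|]; last by rewrite addSn.
  exact: (loses_choose At xy Nt).
have [y xy Ny] := loses_reply open_x Nt.
case: (IHx _ xy t.+1) => [//|]; rewrite addSn => Wy.
exact: (loses_choose At xy Ntc).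
Qed.

End Winning.

(* Simplification identifies two presentations of multiplicities, which lia
   would treat as different atoms. *)
Ltac size_lia := simpl in *; lia.
Ltac count_lia := repeat (case: eqP => [<-|_] /=); size_lia.

(** * Detours *)

Fixpoint reach k m (x y : position) :=
  if m is m'.+1 then exists2 w, move k x w & reach k m' w y else x = y.

Lemma reach1 k x y : move k x y -> reach k 1 x y.
Proof. by exists y. Qed.

Lemma reach_trans k m n x y z :
  reach k m x y -> reach k n y z -> reach k (m + n) x z.
Proof.
elim: m x => [x <- //|m IHm x [w xw wy] yz].
by exists w => //; apply: IHm.
Qed.

(** The exchange behind every use of strategy stealing: the direct way is one
    move, the detour merges the two ones first. *)
Lemma reach_triple k z : 0 < k ->
  reach k 1 (seq_mset [:: 1; 1; 2] `+` z) (seq_mset (fusion k) `+` z) /\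
  reach k 2 (seq_mset [:: 1; 1; 2] `+` z) (seq_mset (fusion k) `+` z).
Proof.
move=> k_gt0; split; first exact/reach1/move_triple.
apply: (@reach_trans k 1 1) (reach1 (move_pair z k_gt0)); apply: reach1.
have -> : seq_mset [:: 1; 1; 2] `+` z = seq_mset [:: 1; 1] `+` (seq_mset [:: 2] `+` z).
  by mset_lia.
have -> : seq_mset [:: 2; 2] `+` z = seq_mset [:: 2] `+` (seq_mset [:: 2] `+` z).
  by mset_lia.
exact: move_ones.
Qed.

Lemma reach_four k z : 0 < k ->
  reach k 2 (seq_mset [:: 1; 1; 1; 1] `+` z) (seq_mset [:: 2; 2] `+` z) /\
  reach k 2 (seq_mset [:: 1; 1; 1; 1] `+` z) (seq_mset (fusion k) `+` z).
Proof.
move=> k_gt0.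
have first_two : reach k 1 (seq_mset [:: 1; 1; 1; 1] `+` z) (seq_mset [:: 1; 1; 2] `+` z).
  have -> : seq_mset [:: 1; 1; 1; 1] `+` z
      = seq_mset [:: 1; 1] `+` (seq_mset [:: 1; 1] `+` z) by mset_lia.
  have -> : seq_mset [:: 1; 1; 2] `+` z
      = seq_mset [:: 2] `+` (seq_mset [:: 1; 1] `+` z) by mset_lia.
  exact/reach1/move_ones.
split; apply: (@reach_trans k 1 1 _ _ _ first_two); last by have [] := reach_triple z k_gt0.
have -> : seq_mset [:: 1; 1; 2] `+` z
    = seq_mset [:: 1; 1] `+` (seq_mset [:: 2] `+` z) by mset_lia.
have -> : seq_mset [:: 2; 2] `+` z
    = seq_mset [:: 2] `+` (seq_mset [:: 2] `+` z) by mset_lia.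
exact/reach1/move_ones.
Qed.

Lemma not_terminal k x y : move k x y -> ~ terminal k x.
Proof. by move=> xy /(_ y). Qed.

Lemma seq_mset_cancel (s : seq nat) (a b : position) :
  seq_mset s `+` a = seq_mset s `+` b -> a = b.
Proof. exact: (can_inj (@msetDKB _ _)). Qed.

Lemma open_ones k (x : position) : 0 < k -> 2 <= x 1 -> exists y, move k x y.
Proof.
move=> k_gt0 x1; have [v /=|z ->] := @split_position [:: 1; 1] x.
  by count_lia.
by eexists; apply: move_ones.
Qed.

Lemma open_twos k (x : position) : 0 < k -> 2 <= x 2 -> exists y, move k x y.
Proof.
move=> k_gt0 x2; have [v /=|z ->] := @split_position [:: 2; 2] x.
  by count_lia.
by eexists; apply: move_pair.
Qed.

(** * Tactics of the team *)

Section Tactics.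
Variables (k : nat) (A : nat -> Prop).
Hypothesis k_gt0 : 0 < k.
Local Notation wins := (wins k A).

Lemma wins_reach m t x y :
  (forall i, i < m -> A (t + i)) -> reach k m x y -> wins (t + m) y -> wins t x.
Proof.
elim: m t x => [|m IHm] t x At; first by rewrite addn0 => ->.
case=> w xw wy; rewrite addnS => Wy; apply: (wins_choose _ xw).
  by rewrite -[t]addn0; apply: At.
apply: IHm wy _; last by rewrite addSn.
by move=> i lt_im; rewrite addSnnS; apply: At.
Qed.

(** Whatever the moves, each of them uses up at most two ones. *)
Lemma wins_wait m t (x : position) : 2 * m <= x 1 ->
  (forall y : position, x 1 <= y 1 + 2 * m -> wins (t + m) y) -> wins t x.
Proof.
elim: m t x => [|m IHm] t x le_mx Wy.
  by rewrite -[t]addn0; apply: Wy; rewrite addn0.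
have [y xy] : exists y, move k x y by apply: open_ones => //; size_lia.
apply: wins_reply (not_terminal xy) _ => {xy}y xy.
have le_xy : x 1 <= y 1 + 2.
  by case: (move_effect k_gt0 xy) => [[z [-> ->]]|[]//]; rewrite !msetE2 !mset_seqE /=; size_lia.
apply: IHm => [|w le_yw]; first by size_lia.
by rewrite addSnnS; apply: Wy; size_lia.
Qed.

Lemma wins_make_two t (x : position) : A t -> 2 <= x 1 ->
  (forall y : position, y 1 + 2 = x 1 -> y 2 = (x 2).+1 -> wins t.+1 y) -> wins t x.
Proof.
move=> At x1 Wy; have [v /=|z def_x] := @split_position [:: 1; 1] x.
  by count_lia.
rewrite def_x in Wy *; apply: wins_choose At (move_ones z k_gt0) _.
by apply: Wy; rewrite !msetE2 !mset_seqE /=; size_lia.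
Qed.

Section Apart.
Hypothesis A_apart : forall t, A t \/ A (t + 1).

(** The exchange and its detour fit in two turns, and stealing decides which of
    them to take. *)
Lemma wins_triple t (x : position) : A t -> A t.+1 -> 2 <= x 1 -> 1 <= x 2 -> wins t x.
Proof.
move=> At At1 x1 x2; have [v /=|z ->] := @split_position [:: 1; 1; 2] x.
  by count_lia.
have [short long] := reach_triple z k_gt0.
have At2 i : i < 2 -> A (t + i) by case: i => [|[|]]; rewrite ?addn0 ?addn1.
case: (stealing k_gt0 A_apart (seq_mset (fusion k) `+` z) t) => W.
  by apply: wins_reach short _; [case=> // _; rewrite addn0 | rewrite addn1].
by apply: wins_reach At2 long _; rewrite addn2 -[t.+1]addn1.
Qed.

Lemma wins_AAA t (x : position) : A t -> A t.+1 -> A t.+2 -> 4 <= x 1 -> wins t x.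
Proof.
move=> At At1 At2 x1; apply: wins_make_two => // [|y y1 y2]; first by size_lia.
by apply: wins_triple => //; size_lia.
Qed.

(** The team makes two 2s.  An opponent who fuses them at turn t + 2 yields at
    time t + 3 a position that the team can reach alone at time t + 2; any other
    move takes at most one of the 2s. *)
Lemma wins_AA_AA t (x : position) :
  A t -> A t.+1 -> A t.+3 -> A t.+4 -> 8 <= x 1 -> wins t x.
Proof.
move=> At At1 At3 At4 x1; have [v /=|z def_x] := @split_position [:: 1; 1; 1; 1] x.
  by count_lia.
have z1 : 4 <= z 1 by move: x1; rewrite def_x !msetE2 !mset_seqE /=; size_lia.
have [make_twos make_fusion] := reach_four z k_gt0; rewrite -def_x in make_twos make_fusion.
have At2 i : i < 2 -> A (t + i) by case: i => [|[|]]; rewrite ?addn0 ?addn1.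
case: (stealing k_gt0 A_apart (seq_mset (fusion k) `+` z) t.+1) => W.
  by apply: wins_reach At2 make_fusion _; rewrite addn2.
apply: wins_reach At2 make_twos _; rewrite addn2.
apply: wins_reply (not_terminal (move_pair z k_gt0)) _ => y /(move_effect k_gt0)[].
  by case=> z' [/seq_mset_cancel <- ->]; rewrite addn1 in W.
by rewrite !msetE2 !mset_seqE /= => -[y1 y2]; apply: wins_triple => //; size_lia.
Qed.

End Apart.

Section Adjacent.
Hypothesis A_adjacent : forall t, A t \/ A (t + 2).

(** Two exchanges in a row take two moves, or four with both detours. *)
Lemma wins_double_triple t (x : position) :
  (forall i, i < 4 -> A (t + i)) -> 4 <= x 1 -> 2 <= x 2 -> wins t x.
Proof.
move=> At x1 x2; have [v /=|z ->] := @split_position [:: 1; 1; 2; 1; 1; 2] x.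
  by count_lia.
set y := seq_mset (fusion k) `+` (seq_mset (fusion k) `+` z).
have [m2 m4] : reach k 2 (seq_mset [:: 1; 1; 2; 1; 1; 2] `+` z) y /\
               reach k 4 (seq_mset [:: 1; 1; 2; 1; 1; 2] `+` z) y.
  have -> : seq_mset [:: 1; 1; 2; 1; 1; 2] `+` z
      = seq_mset [:: 1; 1; 2] `+` (seq_mset [:: 1; 1; 2] `+` z) by mset_lia.
  have [s1 l1] := reach_triple (seq_mset [:: 1; 1; 2] `+` z) k_gt0.
  have [s2 l2] := reach_triple (seq_mset (fusion k) `+` z) k_gt0.
  rewrite msetDCA in s2 l2.
  by split; [apply: (reach_trans s1 s2) | apply: (reach_trans l1 l2)].
case: (stealing k_gt0 A_adjacent y t.+1) => W.
  by apply: wins_reach m2 _; [move=> i lt_i; apply: At; size_lia | rewrite addn2].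
by apply: wins_reach At m4 _; have -> : t + 4 = (t.+1 + 2).+1 by lia.
Qed.

(** A round consists of four turns of the team, spent on making 2s, and two
    arbitrary turns.  If both of the latter fuse a pair of the new 2s, the
    position at time t + 6 is one that the team can reach alone at time t + 4.
    Otherwise either exactly one of them fuses, which uses no 1 and two 2s
    while the other uses at most two 1s and one 2, or none does.  The eight 1s
    spent by the team add up with these losses to 10 and 12. *)
Lemma wins_round t (x : position) : (forall i, i < 4 -> A (t + i)) -> 8 <= x 1 ->
  (forall y : position,
      x 1 <= y 1 + 10 /\ x 2 + 1 <= y 2 \/ x 1 <= y 1 + 12 /\ x 2 + 2 <= y 2 ->
    wins (t + 6) y) -> wins t x.
Proof.
move=> At x1 W6; have [v /=|z def_x] := @split_position [:: 1; 1; 1; 1; 1; 1; 1; 1] x.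
  by count_lia.
have cut8 : x = seq_mset [:: 1; 1; 1; 1] `+` (seq_mset [:: 1; 1; 1; 1] `+` z).
  by rewrite def_x; mset_lia.
set y := seq_mset (fusion k) `+` (seq_mset (fusion k) `+` z).
have make_fusions : reach k 4 x y.
  rewrite cut8; have [_ f1] := reach_four (seq_mset [:: 1; 1; 1; 1] `+` z) k_gt0.
  have [_ f2] := reach_four (seq_mset (fusion k) `+` z) k_gt0.
  by rewrite msetDCA in f2; apply: (reach_trans f1 f2).
have make_twos : reach k 4 x (seq_mset [:: 2; 2] `+` (seq_mset [:: 2; 2] `+` z)).
  rewrite cut8; have [f1 _] := reach_four (seq_mset [:: 1; 1; 1; 1] `+` z) k_gt0.
  have [f2 _] := reach_four (seq_mset [:: 2; 2] `+` z) k_gt0.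
  by rewrite msetDCA in f2; apply: (reach_trans f1 f2).
(* Decided beforehand: if the double fusion is good at time t + 4, the team
   heads for it directly, and otherwise it is good at time t + 6. *)
case: (stealing k_gt0 A_adjacent y (t + 3)) => Wy.
  by apply: wins_reach At make_fusions _; rewrite addnS.
rewrite -addnA -addnS in Wy.
have xz : x 1 = 8 + z 1 /\ x 2 = z 2 by rewrite def_x !msetE2 !mset_seqE.
apply: wins_reach At make_twos _.
apply: wins_reply (not_terminal (move_pair _ k_gt0)) _ => u /(move_effect k_gt0)[].
  case=> z' [/seq_mset_cancel <- ->].
  have [u' uu'] : exists u', move k (seq_mset (fusion k) `+` (seq_mset [:: 2; 2] `+` z)) u'.
    by apply: open_twos => //; rewrite !msetE2 !mset_seqE /=; size_lia.
  apply: wins_reply (not_terminal uu') _ => {uu'}u' /(move_effect k_gt0)[].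
    case=> z''; rewrite msetDCA => -[/seq_mset_cancel <- ->].
    by rewrite -!addnS.
  by rewrite !msetE2 !mset_seqE /= -!addnS => u'12; apply: W6; left; size_lia.
rewrite !msetE2 !mset_seqE /= => u12.
have [u' uu'] : exists u', move k u u' by apply: open_twos => //; size_lia.
apply: wins_reply (not_terminal uu') _ => {uu'}u' /(move_effect k_gt0)[].
  case=> z' [def_u ->]; rewrite -!addnS; apply: W6; left.
  by move: u12; rewrite def_u !msetE2 !mset_seqE /=; size_lia.
by rewrite -!addnS => u'12; apply: W6; right; size_lia.
Qed.

(** With one 2 at the start, both outcomes of the round have the two 2s needed
    for a double exchange. *)
Lemma wins_two_blocks t (x : position) : (forall i, i < 4 -> A (t + i)) ->
  (forall i, i < 4 -> A (t + 6 + i)) -> 16 <= x 1 -> 1 <= x 2 -> wins t x.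
Proof.
move=> At At6 x1 x2; apply: wins_round => // [|y y12]; first by size_lia.
by apply: wins_double_triple => //; size_lia.
Qed.

(** In the outcome of the round with two 2s, a double exchange follows at once.
    The other outcome has a single 2, but it has kept two more ones, enough for
    another round. *)
Lemma wins_three_blocks t (x : position) : (forall i, i < 4 -> A (t + i)) ->
  (forall i, i < 4 -> A (t + 6 + i)) -> (forall i, i < 4 -> A (t + 12 + i)) ->
  26 <= x 1 -> wins t x.
Proof.
move=> At At6 At12 x1; apply: wins_round => // [|y [] y12]; first by size_lia.
  apply: wins_two_blocks; [exact: At6 | | size_lia | size_lia].
  by move=> i lt_i; rewrite -(addnA t); apply: At12.
by apply: wins_double_triple => //; size_lia.
Qed.

Lemma wins_six t (x : position) : (forall i, i < 6 -> A (t + i)) -> 8 <= x 1 -> wins t x.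
Proof.
move=> At x1; have At0 : A t by rewrite -[t]addn0; apply: At.
have At1 : A t.+1 by rewrite -addn1; apply: At.
apply: wins_make_two => // [|y y1 y2]; first by size_lia.
apply: wins_make_two => // [|w w1 w2]; first by size_lia.
apply: wins_double_triple; [move=> i lt_i|size_lia|size_lia].
by rewrite -addn2 -addnA; apply: At; size_lia.
Qed.

End Adjacent.
End Tactics.

(** * From winning positions to strategies *)

(** The strategy chooses a move to a winning position whenever there is one;
    since the game terminates, staying on winning positions is enough. *)
Lemma wins_strategy p k n (A : {set 'I_p}) : 0 < k ->
  wins k (on_turn A) 0 (start k n) -> has_winning_strategy k n A.
Proof.
move=> k_gt0 W0.
pose good (s : seq position) y :=
  move k (last (start k n) s) y /\ wins k (on_turn A) (size s).+1 y.
pose sigma s := epsilon (inhabits (start k n)) (good s).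
have sigmaP s : on_turn A (size s) -> ~ terminal k (last (start k n) s) ->
    wins k (on_turn A) (size s) (last (start k n) s) -> good s (sigma s).
  move=> At open_s Ws; apply: epsilon_spec; move: At open_s.
  rewrite /good; case: Ws => [t x y At xy Wy _ _|t x _ Wy _ open_x|t x _ term_x _ /(_ term_x)//].
    by exists y.
  suff [y xy] : exists y, move k x y by exists y; split; last exact: Wy.
  by apply: NNPP => no_y; apply: open_x => y xy; apply: no_y; exists y.
have legal_rcons x s y :
    legal_play k x (rcons s y) <-> legal_play k x s /\ move k (last x s) y.
  by elim: s x => [|w s IHs] x /=; [tauto | rewrite IHs; tauto].
have good_play s : conforming_play k n A sigma s ->
    wins k (on_turn A) (size s) (last (start k n) s).
  elim/last_ind: s => [//|s y IHs] [/legal_rcons[legal_s sy] conf_s].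
  have {}IHs : wins k (on_turn A) (size s) (last (start k n) s).
    apply: IHs; split=> // t lt_t At.
    have := conf_s t; rewrite size_rcons nth_rcons lt_t -cats1 takel_cat ?(ltnW lt_t) //.
    by apply=> //; apply: ltnW.
  rewrite last_rcons size_rcons.
  have open_s : ~ terminal k (last (start k n) s) by move/(_ y).
  have [At|notAt] := classic (on_turn A (size s)).
    have := conf_s (size s); rewrite size_rcons nth_rcons ltnn eqxx -cats1 take_size_cat //.
    move=> /(_ (leqnn _) At) ->; by case: (sigmaP s At open_s IHs).
  move: notAt open_s sy; case: IHs => [t x w At|t x _ Wx _ _|t x _ term_x _ /(_ term_x)//] //.
  exact: Wx.
exists sigma; split=> [s conf_s open_s At|s conf_s|f conf_f].
- by have [] := sigmaP s At open_s (good_play s conf_s).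
- move: (good_play s conf_s); move: (size s) (last _ _) => t x [].
  + by move=> {}t {}x y _ xy _ /(_ y).
  + by move=> {}t {}x open_x _ /open_x.
  + by move=> {}t {}x At _ _; exists t.
- have step m : move k (f m) (f m.+1).
    have [] := conf_f m.+2; rewrite /mkseq -[m.+2]addn1 iotaD map_cat cats1.
    move=> /legal_rcons[_]; rewrite -[m.+1]addn1 iotaD map_cat last_cat /= add0n addn1.
    by [].
  suff: forall x m, x = f m -> False by move/(_ (f 0) 0); apply.
  elim/(well_founded_ind (move_wf k_gt0)) => x IHx m def_x.
  by apply: (IHx (f m.+1) _ m.+1); rewrite ?def_x.
Qed.

(** * Turn orders *)

(** Three turns in a row free of b, or the pattern AABAA, occur within the
    first few turns.  Just after a turn of b this holds unless the next one
    comes two turns later, and then three free turns follow it. *)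
Lemma sparse_window (b : pred nat) : (forall t, ~~ (b t && b t.+1)) ->
    (forall u v w, u < v < w -> w < u + 6 -> ~~ [&& b u, b v & b w]) ->
  exists2 t, t <= 5 &
    [/\ ~~ b t, ~~ b t.+1 & ~~ b t.+2 \/ ~~ b t.+3 /\ ~~ b t.+4].
Proof.
move=> apart sparse.
have after e : e <= 2 -> b e -> exists2 t, t <= 5 &
    [/\ ~~ b t, ~~ b t.+1 & ~~ b t.+2 \/ ~~ b t.+3 /\ ~~ b t.+4].
  move=> le_e2 be; have := apart e; rewrite be => be1.
  have [be2|be2] := boolP (b e.+2).
    exists e.+3; first by lia.
    have := apart e.+2; rewrite be2 => be3.
    have := sparse e e.+2 e.+4; rewrite be be2 => be4.
    have := sparse e e.+2 e.+4.+1; rewrite be be2 => be5.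
    by split; [|apply: be4; lia|left; apply: be5; lia].
  exists e.+1; first by lia.
  split=> //; have [be3|be3] := boolP (b e.+3); [right | by left].
  have := apart e.+3; rewrite be3 => be4.
  have := sparse e e.+3 e.+4.+1; rewrite be be3 => be5.
  by split; last by apply: be5; lia.
have [/after|b0] := boolP (b 0); first exact.
have [/after|b1] := boolP (b 1); first exact.
have [/after|b2] := boolP (b 2); first exact.
by exists 0 => //; split=> //; left.
Qed.

Lemma wins_apart k (A : nat -> Prop) (b : pred nat) (x : position) : 0 < k ->
    (forall t, ~~ b t -> A t) -> (forall t, ~~ (b t && b t.+1)) ->
    (forall u v w, u < v < w -> w < u + 6 -> ~~ [&& b u, b v & b w]) ->
  18 <= x 1 -> wins k A 0 x.
Proof.
move=> k_gt0 turnA apart sparse x1.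
have A_apart t : A t \/ A (t + 1).
  have [bt|/turnA] := boolP (b t); [right | by left].
  by apply: turnA; have := apart t; rewrite bt addn1.
have [t le_t5 [/turnA At /turnA At1 At2]] := sparse_window apart sparse.
apply: (wins_wait k_gt0 (m := t)) => [|y]; first by lia.
rewrite add0n => y1; case: At2 => [/turnA At2|[/turnA At3 /turnA At4]].
  by apply: wins_AAA => //; size_lia.
by apply: wins_AA_AA => //; size_lia.
Qed.

(** The phase (t + c) mod p is 0 or 1 at the turns of the opponents, so that
    phase 2 opens a block of p - 2 turns of the team.  Unless six turns of the
    team remain at once, phase 2 is awaited: at most five moves for p = 6, six
    for p = 7, and seven for p >= 8. *)
Lemma wins_adjacent k (A : nat -> Prop) p c (x : position) : 0 < k -> 6 <= p ->
  (forall t, 1 < (t + c) %% p -> A t) -> 36 <= x 1 -> wins k A 0 x.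
Proof.
move=> k_gt0 p_ge6 A_phase x1; have p_gt0 : 0 < p by lia.
pose phase t := (t + c) %% p.
have phaseD t i : phase (t + i) = (phase t + i) %% p.
  by rewrite /phase modnDml addnAC.
have phase_lt t : phase t < p by apply: ltn_pmod.
have A_shift t : A t \/ A (t + 2).
  have [/A_phase|le_t] := ltnP 1 (phase t); [by left | right].
  by apply: A_phase; rewrite -/(phase _) phaseD modn_small; lia.
have s_lt := ltn_pmod (p + 2 - phase 0) p_gt0.
set s := (p + 2 - phase 0) %% p in s_lt.
have phase_s : phase s = 2.
  rewrite -[s]add0n phaseD modnDmr addnC subnK ?modnDl ?modn_small //; first by lia.
  by have := phase_lt 0; lia.
have A_after i : 1 < (2 + i) %% p -> A (s + i).
  by move=> lt1; apply: A_phase; rewrite -/(phase _) phaseD phase_s.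
have [p6|p7|p8] : [\/ p = 6, p = 7 | 8 <= p].
- move: p_ge6; rewrite leq_eqVlt => /predU1P[<-|]; first by apply: Or31.
  by rewrite leq_eqVlt => /predU1P[<-|]; [apply: Or32 | apply: Or33].
- have A_block q i : i < 4 -> A (s + 6 * q + i).
    move=> lt_i; rewrite -addnA; apply: A_after.
    by rewrite p6 addnCA mulnC modnMDl modn_small; lia.
  apply: (wins_wait k_gt0 (m := s)) => [|y]; first by lia.
  rewrite add0n => y1; apply: wins_three_blocks => //; last by size_lia.
  + by move=> i; have := A_block 0 i; rewrite addn0.
  + exact: (A_block 1).
  + exact: (A_block 2).
- have A_after7 i : i < 12 -> i \notin [:: 5; 6] -> A (s + i).
    move=> lt_i i56; apply: A_after; rewrite p7.
    by do 12!case: i lt_i i56 => [|i] // lt_i i56.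
  (* The first turn of a block of five supplies the 2 that the other four need. *)
  have As : A s by rewrite -[s]addn0; apply: A_after7.
  apply: (wins_wait k_gt0 (m := s)) => [|y]; first by lia.
  rewrite add0n => y1; apply: wins_make_two => // [|w w1 w2]; first by size_lia.
  apply: wins_two_blocks => //; [| |size_lia|size_lia].
  + by move=> i lt_i; rewrite addSnnS; apply: A_after7; rewrite ?inE; lia.
  + by move=> i lt_i; rewrite -addnA addSnnS; apply: A_after7; rewrite ?inE; lia.
have [/andP[le2 le_p]|far] := boolP (1 < phase 0 <= p - 6).
  apply: wins_six => //; last by size_lia.
  by move=> i lt_i; apply: A_phase; rewrite -/(phase _) phaseD modn_small; lia.
have s7 : s <= 7.
  have := phase_lt 0; have [le1|gt1] := leqP (phase 0) 1.
    by move=> _; rewrite /s -addnBA ?modnDl ?modn_small; lia.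
  by move=> lt_p; rewrite /s modn_small; lia.
apply: (wins_wait k_gt0 (m := s)) => [|y]; first by lia.
rewrite add0n => y1; apply: wins_six => //; last by size_lia.
by move=> i lt_i; apply: A_after; rewrite modn_small; lia.
Qed.

Theorem theorem1p10 (p k n : nat) (hp : 6 <= p) (hk : 1 <= k) (hn : 36 <= n)
    (A B : {set 'I_p}) (hAB : partition [set A; B] [set: 'I_p])
    (hA : #|A| = p - 2) (hB : #|B| = 2) :
  has_winning_strategy k n A.
Proof.
apply: wins_strategy => //.
have start1 : 36 <= start k n 1 by rewrite /start nacci1 msetnxx.
have p_gt0 : 0 < p by lia.
pose res t : 'I_p := Ordinal (ltn_pmod t p_gt0).
have turnA t : res t \notin B -> on_turn A t.
  move=> notB; exists (res t) => //.
  have : res t \in cover [set A; B] by rewrite (cover_partition hAB) inE.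
  by case/bigcupP=> C; rewrite !inE => /orP[/eqP-> //|/eqP->]; rewrite (negPf notB).
have small (s : seq 'I_p) : uniq s -> {subset s <= B} -> size s <= 2.
  by move=> /card_uniqP<- sB; rewrite -hB; apply/subset_leq_card/subsetP.
have [[u [Bu Bu1]]|apart] := classic (exists u, res u \in B /\ res u.+1 \in B).
  apply: (@wins_adjacent _ _ p (p - u %% p)) => // t lt1t.
  pose phase t := (t + (p - u %% p)) %% p.
  have phase_u : phase u = 0.
    by rewrite /phase -modnDml subnKC ?modnn // ltnW ?ltn_pmod.
  have phase_u1 : phase u.+1 = 1.
    by rewrite /phase -addn1 addnAC -modnDml -/(phase u) phase_u modn_small //; lia.
  have phaseE v : res t = res v -> phase t = phase v.
    by move=> /(congr1 val)/= eq_tv; rewrite /phase -modnDml eq_tv modnDml.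
  apply: turnA; apply/negP => Bt.
  have : ~~ uniq [:: res u; res u.+1; res t].
    apply/negP => /small; suff sB : {subset [:: res u; res u.+1; res t] <= B} by move/(_ sB).
    by move=> i; rewrite !inE => /or3P[] /eqP->.
  rewrite /= !inE andbT negb_and !negbK -orbA => /or3P[] /eqP.
  - move/(congr1 val)/eqP => /=; rewrite -[X in X == _ %[mod _]]addn0 -addn1 eqn_modDl.
    by rewrite !modn_small //; lia.
  - by move/esym/phaseE; rewrite phase_u => E; rewrite -/(phase t) E in lt1t.
  - by move/esym/phaseE; rewrite phase_u1 => E; rewrite -/(phase t) E in lt1t.
apply: (wins_apart (b := fun t => res t \in B)) => // [t|u v w /andP[lt_uv lt_vw] lt_wu|].
- by apply/andP=> -[Bt Bt1]; apply: apart; exists t.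
- apply/and3P => -[Bu Bv Bw].
  have res_neq i j : i < j -> j < i + p -> res i != res j.
    move=> lt_ij lt_ji; apply/eqP => /(congr1 val)/= /eqP.
    by rewrite eq_sym eqn_mod_dvd ?(ltnW lt_ij) // => /dvdn_leq; lia.
  suff /small : uniq [:: res u; res v; res w].
    suff sB : {subset [:: res u; res v; res w] <= B} by move/(_ sB).
    by move=> i; rewrite !inE => /or3P[] /eqP->.
  by rewrite /= !inE negb_or !res_neq //; lia.
- by apply: leq_trans start1.
Qed.
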